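(* Let $G=\{(x,y)\in[0,1]\times[0,1]: x\ge y\}$ and suppose $0\le p<q\le 1$. Then $\operatorname{ent}(G\cup\{(p,q)\})=\infty$, while $\operatorname{ent}(G)=0$.
   Context: Let $I=[0,1]$; open intervals in $I$ are open relative to $I$. A minimal open cover of $I$ by open intervals is a finite collection $\alpha=\{\alpha_1,\dots,\alpha_n\}$ of open intervals covering $I$ such that no subcollection of smaller cardinality covers $I$. For a closed set $A\subset I\times I$ and a positive integer $m$, let $\star_{i=1}^m A=\{(x_0,\dots,x_m)\in I^{m+1}:(x_{i-1},x_i)\in A\text{ for }1\le i\le m\}$ and $\mathbf{A}=\star_{i=1}^\infty A=\{(x_0,x_1,\dots)\in I^\infty:(x_{i-1},x_i)\in A\text{ for all }i\ge1\}$. Let $\alpha^{m+1}=\{\alpha_{k_0}\times\cdots\times\alpha_{k_m}: k_j\in\{1,\dots,n\}\}$, and let $N(K,\mathcal U)$ be the least cardinality of a subcollection of $\mathcal U$ covering $K$. If $\mathbf{A}\neq\emptyset$, define $\operatorname{ent}(A,\alpha)=\lim_{m\to\infty}\frac1m\log N(\star_{i=1}^mA,\alpha^{m+1})$ (the limit exists); if $\mathbf{A}=\emptyset$, define $\operatorname{ent}(A,\alpha)=0$. Finally $\operatorname{ent}(A)=\sup_\alpha\operatorname{ent}(A,\alpha)\in[0,\infty]$, the supremum being over all minimal open covers $\alpha$ of $I$ by open intervals. *)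

(* Defs.v *)
From HB Require Import structures.
From mathcomp Require Import all_boot all_order all_algebra.
From mathcomp Require Import all_classical all_reals all_analysis.
Set Implicit Arguments.
Unset Strict Implicit.
Unset Printing Implicit Defensive.
Import Order.TTheory GRing.Theory Num.Theory.
Import numFieldNormedType.Exports.
Local Open Scope classical_set_scope.
Local Open Scope ring_scope.

Definition I01 (R : realType) : set R := `[0, 1]%classic.

Arguments I01 R : clear implicits.

Definition open_interval (R : realType) (U : set R) : Prop :=
  is_interval U /\ exists2 O : set R, open O & U = I01 R `&` O.

(* A collection is given as an indexed family; minimality forces its members
   to be nonempty and pairwise distinct. *)
Definition minimal_open_cover (R : realType) (n : nat)
    (alpha : 'I_n -> set R) : Prop :=
  [/\ forall k, open_interval (alpha k),
      I01 R `<=` \bigcup_(k in [set: 'I_n]) alpha k &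
      forall J : {set 'I_n}, (#|J| < n)%N ->
        ~ (I01 R `<=` \bigcup_(k in [set` J]) alpha k)].

(* [lift ord_max i] and [lift ord0 i] have values [i] and [i.+1]. *)
Definition star (R : realType) (A : set (R * R)) (m : nat) :
    set ('I_m.+1 -> R) :=
  [set x | (forall j, I01 R (x j)) /\
           forall i : 'I_m, A (x (lift ord_max i), x (lift ord0 i))].

Arguments star {R} A m.

Definition star_infty (R : realType) (A : set (R * R)) : set (nat -> R) :=
  [set x | (forall i, I01 R (x i)) /\ forall i, A (x i, x i.+1)].

(* [cover_power alpha d] is the collection of [d]-fold products of members of
   [alpha]. *)
Definition cover_power (R : realType) (n : nat) (alpha : 'I_n -> set R)
    (d : nat) : set (set ('I_d -> R)) :=
  [set [set x : 'I_d -> R | forall j, alpha (k j) (x j)]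
    | k in [set: 'I_d -> 'I_n]].

Arguments cover_power {R n} alpha d.

Definition has_subcover_card (X : Type) (K : set X) (U : set (set X))
    (c : nat) : Prop :=
  exists V : set (set X),
    [/\ V `<=` U, (V #= `I_c)%card & K `<=` \bigcup_(B in V) B].

(* The default value 0 is only taken when no finite subcollection covers. *)
Definition cover_number (X : Type) (K : set X) (U : set (set X)) : nat :=
  xget 0%N [set c | has_subcover_card K U c /\
                    forall c', has_subcover_card K U c' -> (c <= c')%N].

(* [lim] is total, but the sequence does converge when [star_infty A] is
   nonempty, by subadditivity. *)
Definition ent_cover (R : realType) (A : set (R * R)) (n : nat)
    (alpha : 'I_n -> set R) : R :=
  if `[< star_infty A !=set0 >] then
    lim ((fun m : nat => m%:R^-1 *
            ln (cover_number (star A m) (cover_power alpha m.+1))%:R)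
         @ \oo)
  else 0.

Definition ent (R : realType) (A : set (R * R)) : \bar R :=
  ereal_sup [set e : \bar R | exists (n : nat) (alpha : 'I_n -> set R),
    minimal_open_cover alpha /\ e = (ent_cover A alpha)%:E].

Definition Gset (R : realType) : set (R * R) :=
  [set z | [/\ I01 R z.1, I01 R z.2 & z.2 <= z.1]].
Arguments Gset R : clear implicits.

(* Main.v *)
Require Import Defs.
From HB Require Import structures.
From mathcomp Require Import all_boot all_order all_algebra.
From mathcomp Require Import all_classical all_reals all_analysis.
From mathcomp Require Import lra zify.
Import Order.TTheory GRing.Theory Num.Theory.
Import numFieldNormedType.Exports.
Local Open Scope classical_set_scope.
Local Open Scope ring_scope.

(** An orbit of [G] is a nonincreasing sequence in [0, 1], and the only freedom
    it has is when to pass from one part of the interval to the next.  Given a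
    cover by [n] intervals, order them by how far to the right they reach and
    code each point by the last interval containing it.  This code is monotone
    in the point ([monotone_selection]), so a nonincreasing orbit has a
    monotone itinerary, and a monotone word of length [m + 1] over [n] letters
    is determined by how many of its letters lie above each threshold
    ([card_antitone_words]).  Hence [N m <= (m + 2) ^ n], polynomial in [m], and
    every [ent_cover] vanishes.

    Adding the single point [(p, q)] allows an orbit to climb back from [p] to
    [q].  In three steps it can go from [q] down to any chosen [y] in [p, q],
    down to [p], and up to [q] again, so [L] choices of [y] yield about
    [L ^ (m / 3)] orbits of length [m] ([excursion_orbit]).  If the [y]'s are
    nodes of a grid, and the cover consists of the open intervals reaching from
    each node to its two neighbours, then no interval contains two nodes, so
    these orbits lie in distinct boxes of the product cover
    ([cover_number_grid_ge]).  The entropy is therefore at least [ln L / 6] for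
    every [L].

    The lower bound on the limit needs the limit to exist.  It does by Fekete's
    lemma ([fekete_cvg]), since [N (m + k) <= N m * N k]: an orbit is
    covered by gluing a box for its beginning to a box for its end
    ([cover_number_submul]). *)

(** * Covering numbers through indexed families *)

(** Subcollections are counted up to equality of their members, whereas
    arguments produce families indexed by a finite type, possibly with
    repetitions; hence the inequality on [c]. *)
Lemma indexed_subcover_card (X : Type) (K : set X) (U : set (set X))
    (T : finType) (f : T -> set X) :
  (forall t, U (f t)) -> K `<=` \bigcup_t f t ->
  exists2 c, (c <= #|T|)%N & has_subcover_card K U c.
Proof.
move=> Uf Kf; pose g (i : 'I_#|T|) := f (enum_val i).
have [c gc] : exists c, (range g #= `I_c)%card.
  by apply/finite_setP; apply: finite_image; apply: finite_finset.
exists c.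
  rewrite -card_le_II -(card_le_eql gc) (card_le_eqr card_II).
  exact: card_image_le.
exists (range g); split=> //; first by move=> _ [i _ <-]; exact: Uf.
move=> x /Kf [t _ fx]; exists (f t) => //.
by exists (enum_rank t) => //; rewrite /g enum_rankK.
Qed.

(** The default value in [cover_number] is discarded as soon as one finite
    subcover exists, by the well-ordering of the naturals. *)
Lemma cover_number_min (X : Type) (K : set X) (U : set (set X)) (c : nat) :
  has_subcover_card K U c ->
  has_subcover_card K U (cover_number K U) /\ (cover_number K U <= c)%N.
Proof.
move=> Kc; rewrite /cover_number.
have /xgetPex : exists d, (has_subcover_card K U d /\
    forall c', has_subcover_card K U c' -> (d <= c')%N).
  have ex : exists d, `[< has_subcover_card K U d >] by exists c; apply/asboolP.
  case: (ex_minnP ex) => d /asboolP Kd dmin.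
  by exists d; split=> // c' Kc'; apply: dmin; apply/asboolP.
by move=> /(_ 0%N) [Kd dmin]; split=> //; exact: dmin.
Qed.

Lemma cover_number_le_card (X : Type) (K : set X) (U : set (set X))
    (T : finType) (f : T -> set X) :
  (forall t, U (f t)) -> K `<=` \bigcup_t f t -> (cover_number K U <= #|T|)%N.
Proof.
move=> Uf Kf; have [c cT Kc] := indexed_subcover_card _ _ _ _ _ Uf Kf.
by have [_ /leq_trans] := cover_number_min _ _ _ _ Kc; apply.
Qed.

Lemma cover_number_attained (X : Type) (K : set X) (U : set (set X))
    (T : finType) (f : T -> set X) :
  (forall t, U (f t)) -> K `<=` \bigcup_t f t ->
  exists g : 'I_(cover_number K U) -> set X,
    (forall i, U (g i)) /\ K `<=` \bigcup_i g i.
Proof.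
move=> Uf Kf; have [c _ Kc] := indexed_subcover_card _ _ _ _ _ Uf Kf.
have [[V [VU]]] := cover_number_min _ _ _ _ Kc.
rewrite card_eq_sym => /card_set_bijP [g [gV ginj gsurj]] KV _.
exists (fun i => g i); split; first by move=> i; apply/VU/gV => /=.
move=> x /KV [B VB Bx]; have [i /= ilt gB] := gsurj B VB.
by exists (Ordinal ilt) => //=; rewrite gB.
Qed.

(** The standard lower bound on covering numbers: pigeonhole on a set of points
    that the collection separates. *)
Lemma card_le_cover_number (X : Type) (K : set X) (U : set (set X))
    (T S : finType) (f : T -> set X) (x : S -> X) :
  (forall t, U (f t)) -> K `<=` \bigcup_t f t ->
  (forall s, K (x s)) ->
  (forall B, U B -> forall s s', B (x s) -> B (x s') -> s = s') ->
  (#|S| <= cover_number K U)%N.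
Proof.
move=> Uf Kf Kx sep.
have [g [Ug Kg]] := cover_number_attained _ _ _ _ _ Uf Kf.
have /choice [h hP] : forall s, exists i, g i (x s).
  by move=> s; have [i _ gi] := Kg _ (Kx s); exists i.
rewrite -[cover_number K U]card_ord; apply: (leq_card h) => s s' hs.
by apply: (sep _ (Ug (h s))); rewrite // hs.
Qed.

(** * Fekete's lemma *)

(** Fekete's lemma for nonnegative sequences: the limit is the infimum of
    [a m / m].  If [k] nearly attains it, dividing [m] by [k] with remainder
    bounds [a m / m] by [a k / k] up to an error of order [1 / m]. *)
Lemma fekete_cvg (R : realType) (a : nat -> R) :
  (forall m, 0 <= a m) -> (forall m k, a (m + k)%N <= a m + a k) ->
  cvg ((m%:R^-1 * a m) @[m --> \oo]).
Proof.
move=> a0 aD; pose E := [set m.+1%:R^-1 * a m.+1 | m in [set: nat]].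
have Elb : has_lbound E.
  by exists 0 => _ [m _ <-]; rewrite mulr_ge0 ?invr_ge0.
have E0 : E !=set0 by exists (1%:R^-1 * a 1%N), 0%N.
apply/cvg_ex; exists (inf E); apply/cvgrPdist_lt => e e0.
have [|_ [k _ <-] kE] := @inf_adherent _ E (e / 2) _ (conj E0 Elb).
  by rewrite divr_gt0.
have aM d r : a (d * k.+1 + r)%N <= d%:R * a k.+1 + a r.
  elim: d => [|d IHd]; first by rewrite mul0n mul0r add0n add0r.
  rewrite mulSn -addnA (le_trans (aD _ _))// -natr1 mulrDl mul1r.
  by move: IHd; lra.
(* [C] is a bound, uniform in the remainder, on the leftover term [a r]. *)
pose C := \sum_(r < k.+1) a r.
have aC r : (r < k.+1)%N -> a r <= C.
  move=> rk; rewrite /C (bigD1 (Ordinal rk))//= lerDl.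
  by apply: sumr_ge0 => i _; exact: a0.
near=> m.
have m0 : (0 < m)%N by near: m; exact: nbhs_infty_gt.
have mC : C / (e / 2) < m%:R by near: m; exact: nbhs_infty_gtr.
have mR : 0 < m%:R :> R by rewrite ltr0n.
have lb : inf E <= m%:R^-1 * a m.
  by apply: ge_inf => //; exists m.-1 => //; rewrite prednK.
rewrite ler0_norm ?subr_le0// opprB ltrBlDl.
set s := k.+1%:R^-1 * a k.+1 in kE *.
have aks : a k.+1 = k.+1%:R * s by rewrite /s mulrA divff ?mul1r ?pnatr_eq0.
have s0 : 0 <= s by rewrite mulr_ge0 ?invr_ge0.
rewrite mulrC ltr_pdivrMr//.
have -> : a m = a (m %/ k.+1 * k.+1 + m %% k.+1)%N by rewrite -divn_eq.
apply: le_lt_trans (aM _ _) _; rewrite aks mulrA -natrM.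
have := aC _ (ltn_pmod m (ltn0Sn k)).
have : (m %/ k.+1 * k.+1)%:R * s <= m%:R * s.
  by rewrite ler_wpM2r // ler_nat leq_trunc_div.
have : m%:R * s < m%:R * (inf E + e / 2) by rewrite ltr_pM2l.
move: mC; rewrite ltr_pdivrMr ?divr_gt0//.
lra.
Unshelve. all: by end_near. Qed.

(** * Orbit segments and product covers *)

(** Stating the transition condition on all pairs of consecutive indices frees
    the later arguments from the [lift]s of the definition. *)
Lemma starP (R : realType) (A : set (R * R)) (m : nat) (x : 'I_m.+1 -> R) :
  star A m x <-> (forall j, I01 R (x j)) /\
    forall i j : 'I_m.+1, j = i.+1 :> nat -> A (x i, x j).
Proof.
split=> [[xI Ax]|[xI Ax]]; split=> //.
  move=> i j ji; have im : (i < m)%N by move: (ltn_ord j); rewrite ji.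
  have := Ax (Ordinal im); congr (A (x _, x _)); apply: val_inj => /=.
    by rewrite /bump leqNgt im.
  by rewrite ji.
by move=> i; apply: Ax; rewrite lift0 lift_max.
Qed.

Lemma star_shift (R : realType) (A : set (R * R)) (m l s : nat)
    (x : 'I_m.+1 -> R) :
  (s + l <= m)%N -> star A m x ->
  star A l (fun i => x (inord (s + i))).
Proof.
move=> slm /starP [xI Ax]; apply/starP; split=> // i j ji.
have jl := ltn_ord j.
by apply: Ax; rewrite !inordK; lia.
Qed.

Lemma star_prefix (R : realType) (A : set (R * R)) (m : nat) (x : nat -> R) :
  star_infty A x -> star A m (fun i => x i).
Proof. by move=> [xI Ax]; apply/starP; split=> // i j ->. Qed.

Definition cell {R : realType} {n d : nat} (alpha : 'I_n -> set R)
    (w : 'I_d -> 'I_n) : set ('I_d -> R) :=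
  [set x | forall j, alpha (w j) (x j)].

Lemma cell_cover_power (R : realType) (n d : nat) (alpha : 'I_n -> set R)
    (w : 'I_d -> 'I_n) : cover_power alpha d (cell alpha w).
Proof. by exists w. Qed.

Lemma words_cover_star (R : realType) (A : set (R * R)) (n m : nat)
    (alpha : 'I_n -> set R) :
  I01 R `<=` \bigcup_(k in [set: 'I_n]) alpha k ->
  star A m `<=` \bigcup_(w : {ffun 'I_m.+1 -> 'I_n}) cell alpha w.
Proof.
move=> cov x [xI _].
have /choice [w wP] : forall j, exists k, alpha k (x j).
  by move=> j; have [k _ xk] := cov _ (xI j); exists k.
by exists (finfun w) => // j; rewrite ffunE.
Qed.

Lemma cover_number_words (R : realType) (A : set (R * R)) (n m : nat)
    (alpha : 'I_n -> set R) :
  I01 R `<=` \bigcup_(k in [set: 'I_n]) alpha k ->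
  exists W : 'I_(cover_number (star A m) (cover_power alpha m.+1)) ->
      'I_m.+1 -> 'I_n,
    star A m `<=` \bigcup_i cell alpha (W i).
Proof.
move=> cov.
have [|g [gU gcov]] := cover_number_attained _ _ (cover_power alpha m.+1) _ _ _
  (words_cover_star _ A _ m _ cov); first by move=> w; exact: cell_cover_power.
have /choice [W WP] : forall i, exists w, cell alpha w = g i.
  by move=> i; have [w _ wg] := gU i; exists w.
by exists W => x /gcov [i _ gx]; exists i; rewrite ?WP.
Qed.

(** The two segments share coordinate [m], which the first one
    covers; with [m] counting transitions, not points, this overlap is what
    makes the lengths add up exactly. *)
Lemma cover_number_submul (R : realType) (A : set (R * R)) (n m k : nat)
    (alpha : 'I_n -> set R) :
  I01 R `<=` \bigcup_(k in [set: 'I_n]) alpha k ->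
  (cover_number (star A (m + k)) (cover_power alpha (m + k).+1) <=
   cover_number (star A m) (cover_power alpha m.+1) *
   cover_number (star A k) (cover_power alpha k.+1))%N.
Proof.
move=> cov; have [V VP] := cover_number_words _ A _ m _ cov.
have [W WP] := cover_number_words _ A _ k _ cov.
set M := cover_number (star A m) _ in V VP *.
set K := cover_number (star A k) _ in W WP *.
pose glue (t : 'I_M * 'I_K) (j : 'I_(m + k).+1) : 'I_n :=
  if (j <= m)%N then V t.1 (inord j) else W t.2 (inord (j - m)).
rewrite -[M in leqRHS]card_ord -[K in leqRHS]card_ord -card_prod.
apply: (cover_number_le_card _ _ _ _ (cell alpha \o glue)) => [t|x sx] /=.
  exact: cell_cover_power.
have /VP [i _ Vi] := star_shift _ A _ m 0 _ (leq_addr _ _) sx.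
have /WP [j _ Wj] := star_shift _ A _ k m _ (leqnn _) sx.
exists (i, j) => // l /=; rewrite /glue; case: leqP => lm /=.
  by have := Vi (inord l); rewrite inordK ?add0n ?inord_val.
have := Wj (inord (l - m)).
rewrite inordK; last by have := ltn_ord l; lia.
by rewrite subnKC ?inord_val// ltnW.
Qed.

Lemma cover_number_gt0 (R : realType) (A : set (R * R)) (n m : nat)
    (alpha : 'I_n -> set R) :
  star_infty A !=set0 -> I01 R `<=` \bigcup_(k in [set: 'I_n]) alpha k ->
  (0 < cover_number (star A m) (cover_power alpha m.+1))%N.
Proof.
move=> [x Ax] cov; have [W WP] := cover_number_words _ A _ m _ cov.
have [i _ _] := WP _ (star_prefix _ _ m _ Ax).
exact: leq_ltn_trans (leq0n i) (ltn_ord i).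
Qed.

(** * Existence of the limit *)

Lemma ent_cover_cvg (R : realType) (A : set (R * R)) (n : nat)
    (alpha : 'I_n -> set R) :
  star_infty A !=set0 -> I01 R `<=` \bigcup_(k in [set: 'I_n]) alpha k ->
  cvg ((m%:R^-1 * ln (cover_number (star A m) (cover_power alpha m.+1))%:R : R)
    @[m --> \oo]).
Proof.
move=> A0 cov.
pose N m := cover_number (star A m) (cover_power alpha m.+1).
have N0 m : (0 < N m)%N by exact: cover_number_gt0.
apply: (@fekete_cvg R (fun m => ln (N m)%:R)) => [m|m k].
  by rewrite ln_ge0// ler1n.
rewrite -lnM ?posrE ?ltr0n// -natrM ler_ln ?posrE ?ltr0n ?muln_gt0 ?N0//.
by rewrite ler_nat; exact: cover_number_submul.
Qed.

Lemma ent_cover_ge (R : realType) (A : set (R * R)) (n : nat)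
    (alpha : 'I_n -> set R) (c : R) :
  star_infty A !=set0 -> I01 R `<=` \bigcup_(k in [set: 'I_n]) alpha k ->
  (\forall m \near \oo, c <=
    m%:R^-1 * ln (cover_number (star A m) (cover_power alpha m.+1))%:R) ->
  c <= ent_cover A alpha.
Proof.
move=> A0 cov cN; rewrite /ent_cover asboolT//.
by apply: limr_ge => //; exact: ent_cover_cvg.
Qed.

(** Applying [ln z < z] to [z = (e / 4) * (m + 2)] bounds [ln (m + 2)] by a line
    of slope [e / 4], small enough to leave room for the constant
    [- ln (e / 4)]. *)
Lemma ln_natD2_cvg (R : realType) (C : R) :
  (m%:R^-1 * (C * ln (m.+2)%:R)) @[m --> \oo] --> (0 : R).
Proof.
have base : (m%:R^-1 * ln (m.+2)%:R) @[m --> \oo] --> (0 : R).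
  apply/cvgrPdist_lt => e e0; near=> m.
  have m2 : (2 < m)%N by near: m; exact: nbhs_infty_gt.
  have mR : 0 < m%:R :> R by rewrite ltr0n (leq_trans _ m2).
  have me : - ln (e / 4) / (e / 2) < m%:R by near: m; exact: nbhs_infty_gtr.
  rewrite sub0r normrN ger0_norm; last first.
    by rewrite mulr_ge0 ?invr_ge0// ln_ge0// ler1n.
  rewrite mulrC ltr_pdivrMr//.
  move: me; rewrite ltr_pdivrMr ?divr_gt0// => me.
  have e4 : 0 < e / 4 by rewrite divr_gt0.
  have m2R : 0 < m.+2%:R :> R by rewrite ltr0n.
  have : ln ((e / 4) * m.+2%:R) < (e / 4) * m.+2%:R.
    by rewrite ln_sublinear// mulr_gt0.
  rewrite lnM ?posrE//.
  have : (m.+2%:R : R) <= m%:R * 2 by rewrite -natrM ler_nat; lia.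
  move=> h1 h2; nra.
have -> : (fun m => m%:R^-1 * (C * ln (m.+2)%:R)) =
    (fun m : nat => C * (m%:R^-1 * ln (m.+2)%:R : R)).
  by apply/funext => m; rewrite mulrCA.
by rewrite -[X in _ --> X](mulr0 C); apply: cvgM base; exact: cvg_cst.
Unshelve. all: by end_near. Qed.

(** * Infinite entropy after adding a point above the diagonal *)

Definition grid_cover (R : realType) (N : nat) (k : 'I_N.+1) : set R :=
  I01 R `&` `](k%:R - 1) / N%:R, (k%:R + 1) / N%:R[.

Lemma grid_coverP (R : realType) (N : nat) (k : 'I_N.+1) (x : R) :
  (0 < N)%N -> I01 R x ->
  grid_cover R N k x <-> k%:R - 1 < x * N%:R < k%:R + 1.
Proof.
move=> N0 xI; have NR : 0 < N%:R :> R by rewrite ltr0n.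
rewrite /grid_cover /setI /= in_itv /= ltr_pdivrMr// ltr_pdivlMr//.
by split=> [[]|].
Qed.

(** Each node lies in a single member of the cover: this is used both for the
    minimality of the cover and to separate orbits through distinct nodes. *)
Lemma grid_cover_node (R : realType) (N : nat) (k : 'I_N.+1) (j : nat) :
  (0 < N)%N -> I01 R (j%:R / N%:R) ->
  grid_cover R N k (j%:R / N%:R) <-> j = k.
Proof.
move=> N0 jI; rewrite grid_coverP// divfK ?pnatr_eq0 -?lt0n//.
split=> [|<-]; last by apply/andP; split; lra.
rewrite ltrBlDr !natr1 !ltr_nat; lia.
Qed.

Lemma node_I01 (R : realType) (N j : nat) :
  (0 < N)%N -> (j <= N)%N -> I01 R (j%:R / N%:R).
Proof.
move=> N0 jN; rewrite /I01 /= in_itv /= divr_ge0//=.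
by rewrite ler_pdivrMr ?ltr0n// mul1r ler_nat.
Qed.

Lemma grid_cover_minimal (R : realType) (N : nat) :
  (0 < N)%N -> minimal_open_cover (grid_cover R N).
Proof.
move=> N0; have NR : 0 < N%:R :> R by rewrite ltr0n.
split=> [k|x xI|J Jlt JI].
- split; last by eexists; last reflexivity; exact: interval_open.
  move=> x y [xI xk] [yI yk] z xzy.
  by split; apply: interval_is_interval xzy.
- move: (xI); rewrite /I01 /= in_itv /= => /andP[x0 x1].
  have xN0 : 0 <= x * N%:R by rewrite mulr_ge0// ltW.
  have /andP[lo hi] := truncn_itv xN0.
  have kN : (Num.truncn (x * N%:R) < N.+1)%N.
    rewrite ltnS -(ler_nat R) (le_trans lo)//.
    by rewrite -[leRHS]mul1r ler_wpM2r.
  exists (Ordinal kN) => //; rewrite grid_coverP//=.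
  move: lo hi; rewrite -natr1 => lo hi.
  by apply/andP; split; lra.
- have /existsP[k kJ] : [exists k, k \notin J].
    apply: contraLR Jlt; rewrite negb_exists -leqNgt => /forallP h.
    rewrite -[X in (X <= _)%N]card_ord; apply: subset_leq_card.
    by apply/fintype.subsetP => k _; have := h k; rewrite negbK.
  have kI : I01 R (k%:R / N%:R) by apply: node_I01 => //; rewrite -ltnS.
  have [l /= lJ /grid_cover_node kl] := JI _ kI.
  by move: kJ; rewrite (val_inj (kl N0 kI)) lJ.
Qed.

(** A period [q, y i, p] stays in the triangle; only the return from [p] to [q]
    needs the added point. *)
Definition excursion (R : realType) (p q : R) (y : nat -> R) (j : nat) : R :=
  if (j %% 3 == 0)%N then q else if (j %% 3 == 1)%N then y (j %/ 3)%N else p.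

Lemma excursion_orbit (R : realType) (p q : R) (y : nat -> R) :
  0 <= p -> q <= 1 -> (forall i, p <= y i <= q) ->
  star_infty (Gset R `|` [set (p, q)]) (excursion R p q y).
Proof.
move=> p0 q1 yI.
have pq : p <= q by have /andP[/le_trans] := yI 0%N; apply.
have I z : p <= z <= q -> I01 R z.
  by move=> /andP[pz zq]; rewrite /I01 /= in_itv /=; apply/andP; split; lra.
have eI j : p <= excursion R p q y j <= q.
  by rewrite /excursion; do 2?[case: ifP => _ //]; rewrite ?lexx ?pq.
split=> j; first exact: I.
have := ltn_pmod j (isT : (0 < 3)%N).
have [r0|r0] := eqVneq (j %% 3)%N 0%N.
  move=> _; left; split; rewrite /=; [exact: I|exact: I|].
  rewrite {2}/excursion r0 eqxx; by have /andP[] := eI j.+1.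
have [r1|r1] := eqVneq (j %% 3)%N 1%N.
  move=> _; left; split; rewrite /=; [exact: I|exact: I|].
  rewrite {1}/excursion.
  have -> : (j.+1 %% 3 = 2)%N by lia.
  by have /andP[] := eI j.
move=> r3; right; rewrite /excursion.
have -> : (j.+1 %% 3 = 0)%N by lia.
by rewrite eqxx (negbTE r0) (negbTE r1).
Qed.

(** The excursions through distinct sequences of nodes are separated by the
    coordinates [3 i + 1]; the first [m + 1] coordinates contain
    [(m + 1) / 3] complete excursions. *)
Lemma cover_number_grid_ge (R : realType) (p q : R) (L N m : nat) :
  0 <= p -> q <= 1 -> (L.+1)%:R <= N%:R * (q - p) ->
  (L.+1 ^ (m.+1 %/ 3) <= cover_number (star (Gset R `|` [set (p, q)]) m)
     (cover_power (grid_cover R N) m.+1))%N.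
Proof.
move=> p0 q1 LN.
have N0 : (0 < N)%N.
  by rewrite lt0n; apply/eqP => N0; move: LN; rewrite N0 mul0r lern0.
have NR : 0 < N%:R :> R by rewrite ltr0n.
have L0 : 0 < L.+1%:R :> R by rewrite ltr0n.
(* The nodes [(s + i) / N] with [i <= L] fill the part of [p, q] that begins at
   the first node after [p]. *)
pose s := (Num.truncn (N%:R * p)).+1.
pose c (i : nat) : R := (s + i)%:R / N%:R.
have cI (i : 'I_L.+1) : p <= c i <= q.
  have /andP[lo hi] := truncn_itv (mulr_ge0 (ltW NR) p0).
  have iL : i%:R + 1 <= L.+1%:R :> R by rewrite natr1 ler_nat.
  rewrite /c ler_pdivlMr// ler_pdivrMr// /s natrD -natr1.
  move: hi; rewrite -natr1 => hi.
  have i0 : 0 <= i%:R :> R by [].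
  by apply/andP; split; lra.
have cI01 (i : 'I_L.+1) : I01 R (c i).
  have /andP[pc cq] := cI i.
  by rewrite /I01 /= in_itv /=; apply/andP; split; lra.
set t := (m.+1 %/ 3)%N.
pose y (w : {ffun 'I_t -> 'I_L.+1}) (k : nat) := c (oapp w ord0 (insub k)).
have [_ cov _] := grid_cover_minimal R N N0.
rewrite -[t]card_ord -[L.+1]card_ord -card_ffun.
apply: (card_le_cover_number _ _ _ _ _ _
  (fun w (j : 'I_m.+1) => excursion R p q (y w) j) _
  (words_cover_star _ _ _ _ _ cov)) => [w|w|B [v _ <-] w w' /= Bw Bw'].
- exact: cell_cover_power.
- by apply: star_prefix; apply: excursion_orbit => // i; exact: cI.
apply/ffunP => i; apply: val_inj.
have im : (i * 3 + 1 < m.+1)%N.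
  by have := ltn_ord i; rewrite /t; lia.
have e (u : {ffun 'I_t -> 'I_L.+1}) :
    excursion R p q (y u) (i * 3 + 1) = c (u i).
  by rewrite /excursion modnMDl divnMDl //= addn0 /y valK.
move: (Bw (Ordinal im)) (Bw' (Ordinal im)); rewrite /= !e.
move=> /grid_cover_node => /(_ N0 (cI01 _)) h.
move=> /grid_cover_node => /(_ N0 (cI01 _)) h'.
by apply: (@addnI s); rewrite /= h h'.
Qed.

Lemma ent_add_point (R : realType) (p q : R) :
  0 <= p -> p < q -> q <= 1 -> ent (Gset R `|` [set (p, q)]) = +oo%E.
Proof.
move=> p0 pq q1; apply: eq_infty => r.
(* The factor 6 instead of 3 absorbs the rounding: [m <= 6 * ((m + 1) %/ 3)] as
   soon as [1 < m]. *)
pose L := Num.truncn (expR (6 * r)).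
have rL : 6 * r <= ln L.+1%:R.
  rewrite -[leLHS]expRK ler_ln ?posrE ?expR_gt0 ?ltr0n//.
  by rewrite ltW// truncnS_gt.
pose N := (Num.truncn (L.+1%:R / (q - p))).+1.
have LN : L.+1%:R <= N%:R * (q - p).
  by rewrite -ler_pdivrMr ?subr_gt0// ltW// truncnS_gt.
have Nmin := grid_cover_minimal R N isT.
have [_ cov _] := Nmin.
apply: (@le_trans _ _ (ent_cover (Gset R `|` [set (p, q)])
  (grid_cover R N))%:E); last first.
  by apply: ereal_sup_ubound; exists N.+1, (grid_cover R N).
rewrite lee_fin; apply: ent_cover_ge => //.
  exists (excursion R p q (fun=> p)); apply: excursion_orbit => // _.
  by rewrite lexx ltW.
near=> m.
have m2 : (1 < m)%N by near: m; exact: nbhs_infty_gt.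
have mR : 0 < m%:R :> R by rewrite ltr0n ltnW.
have := cover_number_grid_ge R p q L N m p0 q1 LN.
set M := cover_number _ _; set t := (m.+1 %/ 3)%N => LM.
have M0 : (0 < M)%N by apply: leq_trans LM; rewrite expn_gt0.
have : ln (L.+1 ^ t)%:R <= ln M%:R :> R.
  by rewrite ler_ln ?posrE ?ltr0n ?expn_gt0// ler_nat.
rewrite natrX lnXn ?ltr0n// -[_ *+ t]mulr_natl => tM.
have mt : m%:R <= 6 * t%:R :> R.
  by rewrite -natrM ler_nat /t; lia.
have ln0 : 0 <= ln L.+1%:R :> R by rewrite ln_ge0// ler1n.
rewrite mulrC ler_pdivlMr// (le_trans _ tM)//.
have t0 : 0 <= t%:R :> R by [].
have : m%:R * ln L.+1%:R <= 6 * t%:R * ln L.+1%:R :> R by rewrite ler_wpM2r.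
have : m%:R * (6 * r) <= m%:R * ln L.+1%:R by rewrite ler_pM2l.
lra.
Unshelve. all: by end_near. Qed.

(** * Zero entropy of the triangle *)

(** Initial segments form a chain, so their cardinals tell them apart. *)
Lemma initial_segments_inj (m : nat) (A B : {set 'I_m}) :
  (forall i j : 'I_m, (i <= j)%N -> j \in A -> i \in A) ->
  (forall i j : 'I_m, (i <= j)%N -> j \in B -> i \in B) ->
  #|A| = #|B| -> A = B.
Proof.
move=> Ain Bin AB; apply/eqP; have [sAB|] := boolP (A \subset B).
  by rewrite eqEcard sAB AB /=.
case/subsetPn => a aA aB; rewrite eq_sym eqEcard AB leqnn andbT.
apply/fintype.subsetP => b bB; apply: Ain aA.
by rewrite leqNgt; apply: contra aB => ab; apply: Bin bB; exact: ltnW.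
Qed.

Definition antitone_word {n m : nat} (key : 'I_n -> nat)
    (w : {ffun 'I_m -> 'I_n}) : bool :=
  [forall i : 'I_m, forall j : 'I_m, (i <= j)%N ==> (key (w j) <= key (w i))%N].

(** The positions at which an antitone word is above a given letter form an
    initial segment, known from its length; these [n] lengths in [0, m]
    determine the word. *)
Lemma card_antitone_words (n m : nat) (key : 'I_n -> nat) :
  injective key ->
  (#|{: {w : {ffun 'I_m -> 'I_n} | antitone_word key w}}| <= m.+1 ^ n)%N.
Proof.
move=> keyI; pose up (w : {ffun 'I_m -> 'I_n}) k :=
  [set j | (key k <= key (w j))%N]%SET.
have upin w k : antitone_word key w ->
    forall i j : 'I_m, (i <= j)%N -> j \in up w k -> i \in up w k.
  move=> /forallP wP i j ij; rewrite !inE => /leq_trans; apply.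
  by have /forallP/(_ j)/implyP := wP i; apply.
have upm w k : (#|up w k| < m.+1)%N.
  by rewrite ltnS -[X in (_ <= X)%N]card_ord max_card.
pose T (u : {w : {ffun 'I_m -> 'I_n} | antitone_word key w}) :=
  [ffun k => inord #|up (val u) k| : 'I_m.+1].
suff TI : injective T.
  by apply: leq_trans (leq_card T TI) _; rewrite card_ffun !card_ord.
move=> [w wP] [w' w'P] /ffunP TT; apply: val_inj; apply/ffunP => /= j.
have upE k : up w k = up w' k.
  apply: initial_segments_inj; [exact: upin|exact: upin|].
  by have /(congr1 val) := TT k; rewrite !ffunE /= !inordK.
apply: keyI; apply/eqP; rewrite eqn_leq; apply/andP; split.
  by have : j \in up w (w j) by [rewrite inE]; rewrite upE inE.
by have : j \in up w' (w' j) by [rewrite inE]; rewrite -upE inE.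
Qed.

(** The intervals are preordered by inclusion of the down-sets that they
    generate, and [f x] is the last interval containing [x].  If
    [f y] came strictly before [f x] for some [x <= y], the interval [f x]
    would contain [x] and reach to the right of [y], hence contain [y],
    contradicting the choice of [f y].  Comparing suprema instead would not
    do: they do not see whether the right endpoint 1 belongs to the interval. *)
Lemma monotone_selection (R : realType) (n : nat) (alpha : 'I_n -> set R) :
  (forall k, is_interval (alpha k)) ->
  I01 R `<=` \bigcup_(k in [set: 'I_n]) alpha k ->
  exists (key : 'I_n -> nat) (f : R -> 'I_n),
    [/\ injective key, forall x, I01 R x -> alpha (f x) x &
        forall x y, I01 R x -> I01 R y -> x <= y ->
          (key (f x) <= key (f y))%N].
Proof.
move=> itv cov.
pose e (k l : 'I_n) :=
  `[< forall y, alpha k y -> exists2 z, alpha l z & y <= z >].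
have e_refl : reflexive e by move=> k; apply/asboolP => y ky; exists y.
have e_trans : transitive e.
  move=> l k j /asboolP kl /asboolP lj; apply/asboolP => y /kl[z /lj[t jt zt]].
  by exists t => //; exact: le_trans zt.
have e_total : total e.
  move=> k l.
  have [//|/asboolPn /existsNP[y /not_implyP[ky yl]]] := boolP (e k l).
  apply/asboolP => z lz; exists y => //; rewrite leNgt.
  by apply/negP => yz; apply: yl; exists z => //; exact: ltW.
(* Positions in a sorted enumeration refine the total preorder into a linear
   order; intervals equivalent for [e] may be listed in any order. *)
pose s := sort e (enum 'I_n).
have s_mem k : k \in s by rewrite mem_sort mem_enum.
pose key k := index k s.
have keyI : injective key by move=> k l; apply: (@index_inj _ k s).
have key_le k l : (key k <= key l)%N -> e k l.
  by apply: sorted_leq_index => //; exact: sort_sorted.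
have /choice [f fP] : forall x, exists k, I01 R x ->
    alpha k x /\ forall l, alpha l x -> (key l <= key k)%N.
  move=> x; have [xI|xI] := pselect (I01 R x); last first.
    have [|k _ _] := cov 0; last by exists k.
    by rewrite /I01 /= in_itv /= lexx ler01.
  have [k _ /asboolP kx] := cov x xI.
  case: (@arg_maxnP _ k (fun l => `[< alpha l x >]) key kx).
  move=> l /asboolP lx lmax.
  by exists l => _; split=> // j /asboolP; exact: lmax.
exists key, f; split=> [//|x /fP[]//|x y xI yI xy].
have [fx fxmax] := fP x xI; have [fy fymax] := fP y yI.
rewrite leqNgt; apply/negP => lt.
have /asboolP /(_ y fy) [z fz yz] := key_le _ _ (ltnW lt).
have : alpha (f x) y by apply: (itv _ x z fx fz); rewrite xy yz.
by move=> /fymax; rewrite leqNgt lt.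
Qed.

Lemma star_Gset_antitone (R : realType) (m : nat) (x : 'I_m.+1 -> R) :
  star (Gset R) m x -> forall i j : 'I_m.+1, (i <= j)%N -> x j <= x i.
Proof.
move=> /starP [_ xG] i j /subnKC; move: (j - i)%N => d.
elim: d j => [|d IHd] j jE.
  by rewrite (_ : j = i)//; apply: val_inj; rewrite /= -jE addn0.
have idm : (i + d < m.+1)%N by have := ltn_ord j; lia.
apply: le_trans (IHd (Ordinal idm) erefl).
by have [] := xG (Ordinal idm) j; rewrite //= -jE addnS.
Qed.

Lemma cover_number_Gset_le (R : realType) (n m : nat) (alpha : 'I_n -> set R) :
  minimal_open_cover alpha ->
  (cover_number (star (Gset R) m) (cover_power alpha m.+1) <= m.+2 ^ n)%N.
Proof.
move=> [oi cov _].
have [key [f [keyI falpha fmono]]] :=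
  monotone_selection _ _ _ (fun k => (oi k).1) cov.
apply: leq_trans (card_antitone_words n m.+1 key keyI).
pose W := {w : {ffun 'I_m.+1 -> 'I_n} | antitone_word key w}.
apply: (cover_number_le_card _ _ _ W (fun w => cell alpha (val w))) => [w|x xG].
  exact: cell_cover_power.
have [xI _] := xG.
have wP : antitone_word key [ffun j => f (x j)].
  apply/forallP => i; apply/forallP => j; apply/implyP => ij.
  by rewrite !ffunE; apply: fmono => //; exact: star_Gset_antitone ij.
exists (exist (fun w => is_true (antitone_word key w)) _ wP) => // j /=.
by rewrite ffunE; exact: falpha.
Qed.

Lemma ent_cover_Gset (R : realType) (n : nat) (alpha : 'I_n -> set R) :
  minimal_open_cover alpha -> ent_cover (Gset R) alpha = 0.
Proof.
move=> amin; rewrite /ent_cover; case: asboolP => // G0; apply: cvg_lim => //.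
apply: squeeze_cvgr (cvg_cst 0) (ln_natD2_cvg R n%:R); near=> m.
have m0 : 0 <= m%:R^-1 :> R by rewrite invr_ge0.
have [_ cov _] := amin; have := cover_number_gt0 _ _ n m alpha G0 cov.
have := cover_number_Gset_le _ _ m _ amin.
set N := cover_number _ _ => Nle N0.
rewrite mulr_ge0 ?ln_ge0 ?ler1n//= ler_wpM2l//.
rewrite [leRHS]mulr_natl -lnXn ?ltr0n// -natrX.
by rewrite ler_ln ?posrE ?ltr0n ?expn_gt0// ler_nat.
Unshelve. all: by end_near. Qed.

Lemma ent_Gset (R : realType) : ent (Gset R) = 0%E.
Proof.
rewrite /ent (_ : [set e | _] = [set 0%E]) ?ereal_sup1//.
apply/seteqP; split=> [e [n [alpha [amin ->]]]|_ ->] /=.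
  by rewrite ent_cover_Gset.
have Nmin := grid_cover_minimal R 1 isT.
by exists 2%N, (grid_cover R 1); rewrite ent_cover_Gset.
Qed.

(** * The two entropies *)

Theorem theorem16 (R : realType) (p q : R) (hp : 0 <= p) (hpq : p < q)
    (hq : q <= 1) :
  ent (Gset R `|` [set (p, q)]) = +oo%E /\ ent (Gset R) = 0%E.
Proof. by split; [exact: ent_add_point|exact: ent_Gset]. Qed.
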